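(* Let $I\subseteq\mathbb{R}$ be a nonempty open interval and let $f:I\to\mathbb{R}$ be a function. Let $\lambda_1,\lambda_2\in[0,1]$ be such that $\lambda_1+\lambda_2=1$. (i) With $\omega_2:=\mathrm{e}^{\pi\mathrm{i}}$, the condition $$\sum_{j=1}^2\lambda_j\omega_2^{k(j-1)}\neq0\quad\text{for } k=1$$ is equivalent to $\lambda_1\neq\lambda_2$, i.e., to the condition that not both of $\lambda_1$ and $\lambda_2$ are equal to $\frac12$. (ii) If $\lambda_1\neq\lambda_2$ and the inequality $$f\left(\frac{x_1+x_2}{2}\right)\leq\frac12\Big(f(\lambda_1x_1+\lambda_2x_2)+f(\lambda_2x_1+\lambda_1x_2)\Big)$$ holds for all $x_1,x_2\in I$, then $f$ is Jensen convex on $I$.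
   Context: $\mathrm{i}$ is the imaginary unit. A function $f:I\to\mathbb{R}$ is Jensen convex on $I$ if $f\left(\frac{x+y}{2}\right)\leq\frac{f(x)+f(y)}{2}$ for all $x,y\in I$. *)

(* Defs.v *)
From HB Require Import structures.
From mathcomp Require Import all_boot all_order all_algebra.
From mathcomp Require Import all_classical all_reals all_analysis.
From mathcomp Require Export complex.

Set Implicit Arguments.
Unset Strict Implicit.
Unset Printing Implicit Defensive.

Import Order.TTheory GRing.Theory Num.Theory.
Import numFieldNormedType.Exports.

Local Open Scope classical_set_scope.
Local Open Scope ring_scope.
Local Open Scope complex_scope.

(* The library's [expR] exists on the reals only; this is the same power
   series, with the limit taken for the norm topology of [R[i]]. *)
Definition cexp (R : realType) (z : R[i]) : R[i] :=
  limn (series (fun n : nat => z ^+ n / (n`!)%:R : R[i]^o)).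

Definition omega2 (R : realType) : R[i] := cexp ((pi : R)%:C * 'i).

(* A function [I -> R] is represented by a total [f : R -> R] of which only the
   values on [I] are used; for an interval [I] the midpoint lies in [I]. *)
Definition jensen_convex_on (R : realType) (I : set R) (f : R -> R) : Prop :=
  forall x y : R, I x -> I y -> f ((x + y) / 2) <= (f x + f y) / 2.

(* Main.v *)
Require Import Defs.
From mathcomp Require Import all_boot all_order all_algebra.
From mathcomp Require Import all_classical all_reals all_analysis.
From mathcomp Require Import complex ring lra.
Import Order.TTheory GRing.Theory Num.Theory.
Import numFieldNormedType.Exports.
Local Open Scope classical_set_scope.
Local Open Scope ring_scope.
Local Open Scope complex_scope.

(** For part (i), Euler's formula gives [omega2 R = -1], so the sum in the
    condition is [lambda 1 - lambda 2].  Euler's formula itself is obtained by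
    splitting the exponential series of [i t] into the cosine and sine series
    ([exp_term_imaginary]) and passing to the limit ([cexp_imaginary]).

    For part (ii), the substitution [x1 = p + k], [x2 = p - k] turns the
    hypothesis into the midpoint inequality
    [2 f(p) <= f(p + h) + f(p - h)] with [h = (lambda 1 - lambda 2) k].
    Since [|k| >= |h|], the points [x1] and [x2] may leave [I] although
    [p + h] and [p - h] do not, so the inequality is available only for steps
    [h] small compared with the distance from [p] to the ends of [I].  When [p]
    stays between two given points [x <= y] of the open interval [I], that
    distance is bounded below by some [e > 0] ([open_interval_margin]), and one
    small step [h] serves for all such [p].  The
    inequality then passes from the step [h] to its multiple [(y - x) / 2]:
    around the midpoint [m],
    the sequence [f(m + j h) + f(m - j h)] is convex in [j] and its first
    increment is nonnegative, hence it never goes below its first value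
    [2 f(m)] ([midpoint_le_of_small_step]). *)

Lemma complex_of_real_cvg (R : realType) (a : nat -> R) (l : R) :
  a @ \oo --> l -> (fun n => (a n)%:C : R[i]^o) @ \oo --> (l%:C : R[i]^o).
Proof.
move=> /cvgrPdist_lt al; apply/cvgrPdist_lt => e.
rewrite ltcE => /andP[/eqP ime /= e_gt0].
near=> n.
rewrite -rmorphB normc_def /= expr0n /= addr0 sqrtr_sqr ltcE /= ime eqxx /=.
by near: n; apply: al.
Unshelve. all: by end_near. Qed.

(** Even powers of [i] are real and odd ones purely imaginary, so each term of
    the series contributes to exactly one of the cosine and sine series. *)
Lemma exp_term_imaginary (R : realType) (t : R) (n : nat) :
  (t%:C * 'i) ^+ n / (n`!)%:R = (cos_coeff t n)%:C + 'i * (sin_coeff t n)%:C.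
Proof.
have powi : 'i ^+ n =
    ((~~ odd n)%:R * (-1) ^+ n./2)%:C + 'i * ((odd n)%:R * (-1) ^+ n.-1./2)%:C
    :> R[i].
  have even_pow k : 'i ^+ k.*2 = ((-1) ^+ k)%:C :> R[i].
    by rewrite -mul2n exprM sqr_i rmorphXn rmorphN1.
  rewrite -(odd_double_half n); case: (odd n); rewrite ?add1n ?add0n.
    rewrite exprS even_pow /= odd_double /= uphalf_double doubleK.
    by rewrite mul0r mul1r add0r.
  by rewrite even_pow odd_double /= doubleK mul0r mul1r mulr0 addr0.
rewrite exprMn powi /cos_coeff /sin_coeff !rmorphM !fmorphV !rmorphXn /=.
rewrite !rmorph_nat !rmorphN !rmorph1; ring.
Qed.

Lemma cexp_imaginary (R : realType) (t : R) :
  cexp (t%:C * 'i) = (cos t)%:C + 'i * (sin t)%:C.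
Proof.
rewrite /cexp; apply: (cvg_lim (@norm_hausdorff _ R[i]^o)).
have -> : series (fun n => (t%:C * 'i) ^+ n / (n`!)%:R : R[i]^o) =
    (fun n => (series (cos_coeff t) n)%:C + 'i * (series (sin_coeff t) n)%:C).
  apply/funext => n; rewrite /series /= !rmorph_sum /= mulr_sumr -big_split /=.
  by apply: eq_bigr => k _; rewrite exp_term_imaginary.
have cos_cvg := @complex_of_real_cvg _ _ _ (@is_cvg_series_cos_coeff R t).
have sin_cvg := @complex_of_real_cvg _ _ _ (@is_cvg_series_sin_coeff R t).
rewrite cos.unlock sin.unlock.
exact: (cvgD cos_cvg (@cvgMl_tmp R[i] _ _ _ _ 'i _ sin_cvg)).
Qed.

Lemma omega2E (R : realType) : omega2 R = -1.
Proof.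
by rewrite /omega2 cexp_imaginary cospi sinpi rmorph0
  mulr0 addr0 rmorphN1.
Qed.

(** The increments of a convex sequence increase, so they are all nonnegative
    once the first one is. *)
Lemma convex_seq_head_le (R : realDomainType) (s : nat -> R) (n : nat) :
  s 0%N <= s 1%N ->
  (forall j, (j.+1 < n)%N -> s j.+1 *+ 2 <= s j + s j.+2) ->
  s 0%N <= s n.
Proof.
move=> s01 s_convex.
have step j : (j < n)%N -> s j <= s j.+1.
  elim: j => [//|j IHj] jn.
  by have := IHj (ltnW jn); have := s_convex j jn; rewrite mulr2n; lra.
suff: forall k, (k <= n)%N -> s 0%N <= s k by apply.
elim=> [//|k IHk] kn.
exact: le_trans (IHk (ltnW kn)) (step k kn).
Qed.

(** Propagates the midpoint inequality from the step [d / n.+1] to the step [d].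
    Summing the small inequalities at the two points symmetric about [m] shows
    that [j |-> f (m + j h) + f (m - j h)] is convex; the one at [m] itself says
    that its first increment is nonnegative. *)
Lemma midpoint_le_of_small_step (R : realFieldType) (f : R -> R) (m d : R)
    (n : nat) :
  (forall p, `|p - m| <= `|d| ->
     f p *+ 2 <= f (p + d / n.+1%:R) + f (p - d / n.+1%:R)) ->
  f m *+ 2 <= f (m + d) + f (m - d).
Proof.
set h := d / n.+1%:R => small.
have dE : n.+1%:R * h = d by rewrite /h mulrC divfK// pnatr_eq0.
have inside j : (j <= n.+1)%N -> `|j%:R * h| <= `|d|.
  by move=> jn; rewrite -dE !normrM !normr_nat ler_wpM2r// ler_nat.
pose s j := f (m + j%:R * h) + f (m - j%:R * h).
have s0E : s 0%N = f m *+ 2 by rewrite /s mul0r subr0 addr0 mulr2n.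
have -> : f (m + d) + f (m - d) = s n.+1 by rewrite /s dE.
rewrite -s0E; apply: convex_seq_head_le => [|j jn].
  by rewrite s0E /s mul1r; apply: small; rewrite subrr normr0.
have jin := inside _ (ltnW jn).
have up : `|m + j.+1%:R * h - m| <= `|d|.
  by rewrite [m + _]addrC addrK.
have down : `|m - j.+1%:R * h - m| <= `|d|.
  by rewrite [m - _]addrC addrK normrN.
have := small _ up; have := small _ down; rewrite /s.
have -> : m + j.+1%:R * h + h = m + j.+2%:R * h by rewrite [j.+2%:R]mulrSr; ring.
have -> : m + j.+1%:R * h - h = m + j%:R * h by rewrite [j.+1%:R]mulrSr; ring.
have -> : m - j.+1%:R * h + h = m - j%:R * h by rewrite [j.+1%:R]mulrSr; ring.
have -> : m - j.+1%:R * h - h = m - j.+2%:R * h by rewrite [j.+2%:R]mulrSr; ring.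
rewrite !mulr2n; lra.
Qed.

(** Since [I] is an interval, room around the two points [x] and [y] gives the same room around every point between them. *)
Lemma open_interval_margin (R : realType) (I : set R) (x y : R) :
  open I -> is_interval I -> I x -> I y ->
  exists2 e, 0 < e & forall z, x - e <= z <= y + e -> I z.
Proof.
move=> I_open I_itv Ix Iy.
have room z : I z -> exists2 e, 0 < e & forall w, `|z - w| < e -> I w.
  move=> Iz; have /nbhs_ballP[e /= e_gt0 ball_I] : nbhs z I.
    exact: open_nbhs_nbhs.
  by exists e => // w zw; apply: ball_I.
(* Half the radius, as the end points [x - e] and [y + e] must themselves be in [I]. *)
have [e1 e1_gt0 I1] := room x Ix; have [e2 e2_gt0 I2] := room y Iy.
exists (Num.min e1 e2 / 2) => [|z].
  by rewrite divr_gt0// lt_min e1_gt0.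
have [m1 m2] : Num.min e1 e2 <= e1 /\ Num.min e1 e2 <= e2.
  by rewrite !ge_min !lexx orbT.
have m_gt0 : 0 < Num.min e1 e2 by rewrite lt_min e1_gt0.
move: (Num.min e1 e2) m1 m2 m_gt0 => e e1e e2e e_gt0 zI.
apply: (I_itv (x - e / 2) (y + e / 2)) => //.
- by apply: I1; rewrite subKr gtr0_norm; lra.
- by apply: I2; rewrite opprD addrA subrr sub0r normrN gtr0_norm; lra.
Qed.

(** The change of variables [(x1, x2) |-> (a x1 + b x2, b x1 + a x2)] is
    invertible because [a != b], but its inverse need not preserve [I * I]; this
    is why the inequality is first used for small steps only. *)
Lemma jensen_convex_of_weighted (R : realType) (I : set R) (f : R -> R)
    (a b : R) :
  open I -> is_interval I -> a + b = 1 -> a != b ->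
  (forall x1 x2, I x1 -> I x2 ->
     f ((x1 + x2) / 2) <= 1 / 2 * (f (a * x1 + b * x2) + f (b * x1 + a * x2))) ->
  jensen_convex_on I f.
Proof.
move=> I_open I_itv ab1 ab_neq f_ineq x y.
wlog xy : x y / x <= y => [hwlog Ix Iy|Ix Iy].
  have [/hwlog|/ltW/hwlog] := leP x y; first exact.
  by rewrite addrC [f x + _]addrC; exact.
have [e e_gt0 I_margin] := open_interval_margin _ _ _ _ I_open I_itv Ix Iy.
set m := (x + y) / 2; pose d := (y - x) / 2.
have d_ge0 : 0 <= d by rewrite /d; lra.
have ab0 : a - b != 0 by rewrite subr_eq0.
(* With [n.+1] steps, the preimages of [p + h] and [p - h] under the change of
   variables lie at distance [|d / n.+1 / (a - b)|] from [p]; [n] is chosen to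
   make this smaller than the margin [e]. *)
pose n := Num.truncn (`|d / (a - b)| / e).
have small_shift : `|d / n.+1%:R / (a - b)| < e.
  rewrite mulrAC normrM normfV normr_nat ltr_pdivrMr ?ltr0n//.
  by rewrite -ltr_pdivrMl// [e^-1 * _]mulrC truncnS_gt.
have -> : f m <= (f x + f y) / 2 = (f m *+ 2 <= f (m + d) + f (m - d)).
  have -> : m + d = y by rewrite /m /d; field.
  have -> : m - d = x by rewrite /m /d; field.
  by rewrite ler_pdivlMr// mulr_natr [f y + _]addrC.
apply: (@midpoint_le_of_small_step _ _ _ _ n) => p.
rewrite (ger0_norm d_ge0) ler_norml => /andP[p_ge p_le].
set h := d / n.+1%:R in small_shift *; pose k := h / (a - b).
move: small_shift; rewrite -/k ltr_norml => /andP[k_ge k_le].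
have k_def : (a - b) * k = h by rewrite /k mulrC divfK.
have near_I z : p - e <= z <= p + e -> I z.
  move=> /andP[z_ge z_le]; apply: I_margin; move: p_ge p_le z_ge z_le.
  by rewrite /m /d => *; apply/andP; split; lra.
have := f_ineq (p + k) (p - k).
have -> : (p + k + (p - k)) / 2 = p by field.
have bE : b = 1 - a by lra.
have -> : a * (p + k) + b * (p - k) = p + h by rewrite -k_def bE; ring.
have -> : b * (p + k) + a * (p - k) = p - h by rewrite -k_def bE; ring.
rewrite mulr2n => /(_ (near_I _ _) (near_I _ _)) H.
have {}H : f p <= 1 / 2 * (f (p + h) + f (p - h)).
  by apply: H; apply/andP; split; lra.
lra.
Qed.

Theorem corollary3p5 (R : realType) (I : set R) (f : R -> R)
    (lambda : nat -> R)
    (I_neq0 : I !=set0) (I_open : open I) (I_itv : is_interval I)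
    (lambda1_ge0_le1 : 0 <= lambda 1%N <= 1)
    (lambda2_ge0_le1 : 0 <= lambda 2%N <= 1)
    (lambda_sum : lambda 1%N + lambda 2%N = 1) :
  (* (i) *)
  (((forall k : nat, k = 1%N ->
       \sum_(1 <= j < 3) (lambda j)%:C * omega2 R ^+ (k * (j - 1)) <> 0)
      <-> lambda 1%N <> lambda 2%N)
   /\ (lambda 1%N <> lambda 2%N
      <-> ~ (lambda 1%N = 1 / 2 /\ lambda 2%N = 1 / 2)))
  /\
  (* (ii) *)
  (lambda 1%N <> lambda 2%N ->
   (forall x1 x2 : R, I x1 -> I x2 ->
      f ((x1 + x2) / 2) <=
        1 / 2 * (f (lambda 1%N * x1 + lambda 2%N * x2)
                 + f (lambda 2%N * x1 + lambda 1%N * x2))) ->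
   jensen_convex_on I f).
Proof.
split; [split|].
- have sumE k : k = 1%N -> \sum_(1 <= j < 3) (lambda j)%:C * omega2 R ^+ (k * (j - 1))
      = (lambda 1%N - lambda 2%N)%:C.
    move=> ->; rewrite big_ltn// big_nat1 omega2E.
    by rewrite subnn muln0 expr0 mulr1 mul1n expr1 mulrN1 rmorphB.
  split => [/(_ 1%N erefl) + l12|l12 k /sumE->]; first by rewrite sumE// l12 subrr.
  by move=> /complexI/eqP; rewrite subr_eq0 => /eqP.
- split=> [l12 [l1 l2]|half l12]; first by apply: l12; rewrite l1 l2.
  by apply: half; split; lra.
- move=> /eqP l12; exact: jensen_convex_of_weighted.
Qed.
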